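(* Suppose $X$ is a lossy quantum graph with wavenumber $k=k'+i\alpha$ for $k',\alpha>0$ ($\alpha$ is the loss coefficient, with larger values corresponding to higher loss). For $y\in X$ let $u_y$ denote the fundamental solution to $\Delta u+k^2u=\delta_y$ (it depends on $\alpha$ through $k$). (1) For each $y\in X$, there is a choice of $\alpha$ (say $\alpha_y$), and a threshold $T_y>0$, such that for the fundamental solution $u_y$ (with loss coefficient $\alpha=\alpha_y$) the visibility region $U_y(\alpha_y)=\{x\in X : |u_y(x)|^2>T_y^2\}$ is contractible. (2) The collection $\{U_y(\alpha_y)\}$, $y\in X$, forms a cover of $X$. (3) Suppose that all vertices of $X$ are contained in the compact set $K$. There is therefore a finite subcollection $\{y_1,\dots,y_n\}$ such that $\{U_{y_1}(\alpha_{y_1}),\dots,U_{y_n}(\alpha_{y_n})\}$ covers $X\cap K$. Let $\alpha=\max\{\alpha_{y_1},\dots,\alpha_{y_n}\}$. Then the resulting collection $\{U_{y_1}(\alpha),\dots,U_{y_n}(\alpha)\}$ covers $X\cap K$ and consists of contractible sets. Here $U_y(\alpha)$ denotes the region $\{x\in X : |u_y(x)|^2>T_y^2\}$ formed with the fundamental solution $u_y$ for loss coefficient $\alpha$ and with the threshold $T_y$ of (1).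
   Context: A metric graph is a metric space $X$ such that each $x\in X$ has a neighborhood isometric to a star-shaped set of degree $n_x$, namely $\{te^{2\pi i j/n_x} : 0\le t<r_x,\ j\in\mathbb{Z}\}\subset\mathbb{C}$. A vertex set is a discrete subset $V\subseteq X$ containing all points of $X$ whose degree is not 2; the edges are the path-connected components of $X\setminus V$, each isometric to an open interval (possibly of infinite length). Throughout, $X$ is finite, meaning that finite sets of vertices and edges can be chosen. For a piecewise smooth $f:X\to\mathbb{C}$, the Laplacian is the measure $\Delta f=\frac{d^2f}{dx^2}+\sum_{x\in X}\sigma_x(f)\,\delta_x$, where $\sigma_x(f)$ is the sum of the outgoing directional derivatives of $f$ at $x$ and the first term is understood as a density with respect to length along the edges. A lossy quantum graph is the pairing of the Helmholtz equation $\Delta u+k^2u=\delta_y$, with $k$ a possibly complex wavenumber and $y\in X$ the transmitter location, with the Kirchhoff conditions: $u$ is continuous on $X$, and $\sigma_x(u)=0$ at each point $x\in X$ (other than the source point $y$). A fundamental solution is a solution $u_y$ of this equation satisfying these conditions.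
   Formalization: The fundamental solutions are additionally assumed to vanish at infinity (automatic for compact X), as growing solutions such as sin(k|x|)/(2k) on the line violate (1); (2) and (3) are asserted for one suitable choice of the loss coefficients and thresholds in (1). *)

(* Defs.v *)
From HB Require Import structures.
From mathcomp Require Import all_boot all_order all_algebra.
From mathcomp Require Import all_classical all_reals all_analysis.
From mathcomp Require Export complex.
Import Order.TTheory GRing.Theory Num.Theory.
Import numFieldNormedType.Exports.

Set Implicit Arguments.
Unset Strict Implicit.
Unset Printing Implicit Defensive.

Local Open Scope classical_set_scope.
Local Open Scope ring_scope.
Local Open Scope complex_scope.

(* An isometry from the star { t e^(2 i pi j / n) : 0 <= t < r } onto a
   neighborhood of x that sends the center of the star to x; [arm j t] is the
   image of t e^(2 i pi j / n).  The star carries its path (shortest-distance)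
   metric: |s - t| along an arm, s + t across the center. *)
Record star_chart (R : realType) (X : metricType R) (x : X) := StarChart {
  degree : nat ;
  radius : R ;
  arm : 'I_degree -> R -> X ;
  degree_gt0 : (0 < degree)%N ;
  radius_gt0 : 0 < radius ;
  arm_center : forall j, arm j 0 = x ;
  arm_isometry : forall i j s t, 0 <= s < radius -> 0 <= t < radius ->
    mdist (arm i s) (arm j t) = if i == j then `|s - t| else s + t ;
  arm_nbhs : nbhs x (\bigcup_j (arm j @` `[0, radius[)) }.

Definition metric_graph (R : realType) (X : metricType R) :=
  forall x : X, star_chart x.

Definition path_component (X : topologicalType) (R : realType)
    (A : set X) (x : X) : set X :=
  [set z | exists p : R -> X, [/\ {within `[0, 1], continuous p},
     p 0 = x, p 1 = z & p @` `[0, 1] `<=` A]].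
Arguments path_component {X} R A x.

(* A finite vertex set (hence automatically discrete) with finitely many edges;
   edges are indexed by a finite type and come with a parametrization.  An edge
   is isometric to an open interval with respect to arc length (the distance of
   X may shortcut an edge, for instance a loop), so the parametrization is a
   bijection that preserves distances locally.  Unbounded domains are allowed. *)
Record finite_vertex_set (R : realType) (X : metricType R)
    (G : metric_graph X) := FiniteVertexSet {
  vertex : set X ;
  edge : finType ;
  edge_dom : edge -> set R ;
  edge_map : edge -> R -> X ;
  vertex_finite : finite_set vertex ;
  vertex_degree : forall x, degree (G x) != 2%N -> vertex x ;
  edge_components : [set edge_map e @` edge_dom e | e in [set: edge]] =
    [set path_component R (~` vertex) x | x in ~` vertex] ;
  edge_uniq : injective (fun e => edge_map e @` edge_dom e) ;
  edge_dom_open : forall e, open (edge_dom e) ;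
  edge_dom_itv : forall e, is_interval (edge_dom e) ;
  edge_map_inj : forall e, set_inj (edge_dom e) (edge_map e) ;
  edge_map_isometry : forall e t, edge_dom e t -> \forall s & s' \near t,
    mdist (edge_map e s) (edge_map e s') = `|s - s'| }.

Section Laplacian.
Context (R : realType) (X : metricType R) (G : metric_graph X).

Definition smooth (g : R -> R) := forall n t, derivable (derive1n n g) t 1.

(* Near every point, along each arm, f is the restriction of a smooth function
   on the whole line: f is smooth up to the breakpoints, which are isolated. *)
Definition piecewise_smooth_real (f : X -> R) :=
  forall x (j : 'I_(degree (G x))), exists2 e : R, 0 < e &
    exists2 g : R -> R, smooth g & forall t, 0 < t < e -> f (arm j t) = g t.

Definition outgoing_derivative (f : X -> R) (x : X) (j : 'I_(degree (G x))) : R :=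
  lim ((f (arm j t) - f x) / t @[t --> 0^'+]).

Definition sigma_real (f : X -> R) (x : X) : R :=
  \sum_(j < degree (G x)) outgoing_derivative f j.

Variable V : finite_vertex_set G.

(* Integral over A, with respect to length along the edges, of the density
   which is h e t at the point edge_map e t. *)
Definition length_integral (h : edge V -> R -> R) (A : set X) : R :=
  \sum_(e : edge V) \int[@lebesgue_measure R]_(t in
    edge_dom e `&` edge_map e @^-1` A) h e t.

(* At the breakpoints that are not vertices the density below is a default
   value, which the integral ignores since breakpoints are isolated; they
   contribute through the atoms.  A is meant to be a Borel set contained in a compact set. *)
Definition laplacian_real (f : X -> R) (A : set X) : R :=
  length_integral (fun e => derive1n 2 (f \o edge_map e)) A +
  \sum_(x \in A) sigma_real f x.

Definition piecewise_smooth (f : X -> R[i]) :=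
  piecewise_smooth_real (@complex.Re R \o f) /\
  piecewise_smooth_real (@complex.Im R \o f).

Definition sigma (f : X -> R[i]) (x : X) : R[i] :=
  sigma_real (@complex.Re R \o f) x +i* sigma_real (@complex.Im R \o f) x.

Definition laplacian (f : X -> R[i]) (A : set X) : R[i] :=
  laplacian_real (@complex.Re R \o f) A +i* laplacian_real (@complex.Im R \o f) A.

Definition density_measure (f : X -> R[i]) (A : set X) : R[i] :=
  length_integral (fun e t => complex.Re (f (edge_map e t))) A +i*
  length_integral (fun e t => complex.Im (f (edge_map e t))) A.

Definition borel_relatively_compact (A : set X) :=
  <<s @open X >> A /\ exists2 K, compact K & A `<=` K.

(* The measures involved are locally finite but, on an unbounded graph, need not
   be finite, so their equality is tested on Borel sets inside compact sets. *)
Definition helmholtz (k : R[i]) (y : X) (u : X -> R[i]) :=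
  forall A, borel_relatively_compact A ->
    laplacian u A + k ^+ 2 * density_measure u A = (\1_A y)%:C.

Definition kirchhoff (y : X) (u : X -> R[i]) :=
  continuous (u : X -> R[i]^o) /\ forall x, x != y -> sigma u x = 0.

Definition fundamental_solution (k : R[i]) (y : X) (u : X -> R[i]) :=
  [/\ piecewise_smooth u, helmholtz k y u & kirchhoff y u].

End Laplacian.

(* Selects the physical solution: without a condition at the end of the
   unbounded edges a fundamental solution is not unique, because of the
   exponentially growing solutions.  Void when X is compact. *)
Definition vanishes_at_infinity (R : realType) (X : topologicalType)
    (u : X -> R[i]) :=
  forall e : R, 0 < e ->
    exists2 K : set X, compact K & forall x, ~ K x -> `|u x| < e%:C.

Definition visibility_region (R : realType) (X : Type) (u : X -> R[i]) (T : R) :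
    set X :=
  [set x | T%:C ^+ 2 < `|u x| ^+ 2].

Definition contractible (R : realType) (X : topologicalType) (U : set X) :=
  exists h : R * X -> X,
    [/\ {within `[0, 1] `*` U, continuous h},
        forall t x, 0 <= t <= 1 -> U x -> U (h (t, x)),
        forall x, U x -> h (0, x) = x &
        exists2 c, U c & forall x, U x -> h (1, x) = c].
Arguments contractible R {X} U.

(* Main.v *)
(* Take the same loss coefficient k' + 1 for every source: then Re k^2 < 0, so along
   the edges w = |u_y|^2 satisfies w'' = 2 |u'|^2 - 2 Re(k^2) w >= - 2 Re(k^2) w, i.e.,
   w is convex.  At a point x <> y the Kirchhoff condition makes the outgoing
   derivatives of w sum to zero, so one of them is nonnegative and w increases
   strictly along that arm as soon as w x > 0: w has no positive maximum away
   from y.  As w vanishes at infinity and is not identically zero, it has a strict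
   global maximum at y.  A threshold close enough to this maximum confines the
   visibility region to a star around y, where convexity makes it star-shaped.
   The cover of K is extracted by compactness, and the maximum of the loss
   coefficients is again k' + 1. *)
Require Import Defs.
From mathcomp Require Import all_boot all_order all_algebra.
From mathcomp Require Import all_classical all_reals all_analysis.
From mathcomp Require Import ring lra.
Import Order.TTheory GRing.Theory Num.Theory.
Import numFieldNormedType.Exports.

Set Implicit Arguments.
Unset Strict Implicit.
Unset Printing Implicit Defensive.

Local Open Scope classical_set_scope.
Local Open Scope ring_scope.
Local Open Scope complex_scope.

(** * Real functions *)

Section RealFunctions.
Context {R : realType}.
Implicit Types (g : R -> R) (a b s t : R).

Lemma smooth_is_derive g n t : smooth g ->
  is_derive t 1 (derive1n n g) (derive1n n.+1 g t).
Proof.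
by move=> gs; apply: DeriveDef; [exact: gs | rewrite derive1nS derive1E].
Qed.

Lemma is_derive_continuous g t (d : R) : is_derive t 1 g d ->
  {for t, continuous g}.
Proof.
by move=> [gt _]; apply/differentiable_continuous/derivable1_diffP.
Qed.

Lemma smooth_continuous g n : smooth g -> continuous (derive1n n g).
Proof. by move=> gs t; apply: is_derive_continuous (smooth_is_derive n t gs). Qed.

Lemma MVT_everywhere g (g' : R -> R) a b : a < b ->
  (forall t, is_derive t 1 g (g' t)) ->
  exists2 c, a < c < b & g b - g a = g' c * (b - a).
Proof.
move=> ab dg.
have cg : {within `[a, b], continuous g}.
  by apply: continuous_subspaceT => t; apply: is_derive_continuous (dg t).
have [c cab ->] := MVT ab (fun t _ => dg t) cg.
by exists c.
Qed.

(** A value above both end values would force a positive slope left of [t] and a negative one right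
    of it, hence a negative second derivative in between. *)
Lemma convex_le_max g (g1 g2 : R -> R) a t b :
  (forall s, is_derive s 1 g (g1 s)) -> (forall s, is_derive s 1 g1 (g2 s)) ->
  (forall s, a < s < b -> 0 <= g2 s) -> a < t < b ->
  g t <= Num.max (g a) (g b).
Proof.
move=> dg dg1 g2_ge0 /andP[aLt tLb]; rewrite leNgt gt_max; apply/negP => /andP[ga gb].
have [c1 /andP[ac1 c1t] e1] := MVT_everywhere aLt dg.
have [c2 /andP[tc2 c2b] e2] := MVT_everywhere tLb dg.
have [c3 /andP[c13 c32] e3] := MVT_everywhere (lt_trans c1t tc2) dg1.
have := g2_ge0 c3; rewrite (lt_trans ac1 c13) (lt_trans c32 c2b) => /(_ isT).
have p1 : 0 < g1 c1 by rewrite -(pmulr_lgt0 _ (_ : 0 < t - a)) -?e1 subr_gt0.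
have p2 : g1 c2 < 0 by rewrite -(pmulr_llt0 _ (_ : 0 < b - t)) -?e2 ?subr_lt0 ?subr_gt0.
rewrite leNgt => /negP; apply; rewrite -(pmulr_llt0 _ (_ : 0 < c2 - c1)) -?e3.
  lra.
by rewrite subr_gt0 (lt_trans c1t).
Qed.

Lemma convex_lt g (g1 g2 : R -> R) a b : a < b ->
  (forall s, is_derive s 1 g (g1 s)) -> (forall s, is_derive s 1 g1 (g2 s)) ->
  (forall s, a < s < b -> 0 < g2 s) -> 0 <= g1 a -> g a < g b.
Proof.
move=> ab dg dg1 g2_gt0 g1a.
have [c /andP[ac cb] e1] := MVT_everywhere ab dg.
have [c' /andP[ac' c'c] e2] := MVT_everywhere ac dg1.
have p2 := g2_gt0 c'; rewrite ac' (lt_trans c'c cb) in p2; have {}p2 := p2 isT.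
rewrite -subr_gt0 e1 mulr_gt0 ?subr_gt0 //.
have : 0 < g1 c - g1 a by rewrite e2 mulr_gt0 // subr_gt0.
lra.
Qed.

Lemma continuous_integrable_segment g a b : continuous g ->
  (@lebesgue_measure R).-integrable `[a, b] (EFin \o g).
Proof.
move=> cg; apply: continuous_compact_integrable; first exact: segment_compact.
exact: continuous_subspaceT.
Qed.

Lemma Rintegral_segment_ge g a b (c : R) : a <= b -> continuous g ->
  (forall s, a <= s <= b -> c <= g s) ->
  c * (b - a) <= \int[@lebesgue_measure R]_(s in `[a, b]) g s.
Proof.
move=> ab cg cLg.
have -> : c * (b - a) = \int[@lebesgue_measure R]_(s in `[a, b]) c.
  rewrite Rintegral_cst //= lebesgue_measure_itv /= lte_fin.
  by case: ltgtP ab => //= -> _; rewrite subrr.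
apply: le_Rintegral => //.
  by apply: (@continuous_integrable_segment (cst c)) => s; exact: cvg_cst.
  exact: continuous_integrable_segment.
Qed.

(** If [g t] were positive, [g] would exceed [g t / 2] around [t] and a short centered integral
    would be positive. This turns the integrated Helmholtz equation into a pointwise one. *)
Lemma continuous_integral0 g t (e : R) : 0 < e -> continuous g ->
  (forall d, 0 < d < e -> \int[@lebesgue_measure R]_(s in `[t - d, t + d]) g s = 0) ->
  g t = 0.
Proof.
move=> e0 + ig; wlog gt0 : g ig / 0 < g t => [hw cg|cg].
  have [gt0|gt0|//] := ltgtP 0 (g t); first exact: hw.
  have cNg : continuous (fun s => - g s) by move=> s; apply: (@cvgN R R^o); exact: cg.
  apply: oppr_inj; rewrite oppr0; apply: (hw (fun s => - g s)) cNg.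
    move=> d de; under eq_Rintegral do rewrite -mulN1r.
    by rewrite RintegralZl ?ig ?mulr0 //; exact: continuous_integrable_segment.
  by rewrite oppr_gt0.
have : \forall s \near t, g t / 2 < g s by apply: (cvgr_gt (g t) (cg t)); lra.
move=> /nbhs_ballP[d /= d0 dP].
pose m := Num.min (d / 2) (e / 2).
have m0 : 0 < m by rewrite lt_min !divr_gt0.
have md : m < d by rewrite gt_min; apply/orP; left; lra.
have me : m < e by rewrite gt_min; apply/orP; right; lra.
have := @Rintegral_segment_ge g (t - m) (t + m) (g t / 2).
rewrite ig ?m0 // => /(_ _ cg) h.
have : g t / 2 * (t + m - (t - m)) <= 0.
  apply: h => [|s /andP[s1 s2]]; first lra.
  apply/ltW/dP; rewrite /ball /= ltr_norml; apply/andP; split; lra.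
have : 0 < g t * m by exact: mulr_gt0.
lra.
Qed.

(** A point of the line is determined by its distances to two others: comparing [psi s] with the
    images of [s0] and [s0 + e / 2] leaves a linear equation. *)
Lemma isometry_affine (psi : R -> R) s0 (e : R) : 0 < e ->
  (forall s s', `|s - s0| < e -> `|s' - s0| < e -> `|psi s - psi s'| = `|s - s'|) ->
  exists2 c : R, c ^+ 2 = 1 &
    forall s, `|s - s0| < e -> psi s = psi s0 + c * (s - s0).
Proof.
move=> e0 iso.
have h0 : `|s0 - s0| < e by rewrite subrr normr0.
have e2 : `|e / 2| = e / 2 by rewrite gtr0_norm // divr_gt0.
have h1 : `|s0 + e / 2 - s0| < e by rewrite addrAC subrr add0r e2; lra.
pose c := (psi (s0 + e / 2) - psi s0) / (e / 2).
have c1 : `|c| = 1.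
  by rewrite normrM normfV (iso _ _ h1 h0) addrAC subrr add0r e2 divff // gt_eqF // divr_gt0.
have c21 : c ^+ 2 = 1 by rewrite -(ger0_norm (sqr_ge0 c)) normrX c1 expr1n.
exists c => // s hs.
have A : (psi s - psi s0) ^+ 2 = (s - s0) ^+ 2.
  by rewrite -[LHS]ger0_norm ?sqr_ge0 // normrX iso // -normrX ger0_norm ?sqr_ge0.
have B : (psi s - psi (s0 + e/2)) ^+ 2 = (s - (s0 + e/2)) ^+ 2.
  by rewrite -[LHS]ger0_norm ?sqr_ge0 // normrX iso // -normrX ger0_norm ?sqr_ge0.
have C : psi (s0 + e / 2) = psi s0 + c * (e / 2).
  by rewrite /c divfK ?gt_eqF ?divr_gt0 //; ring.
rewrite C in B.
(* The difference of the squared identities [A] and [B] cancels the quadratic terms. *)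
have D : (psi s - psi s0) * c * e = (s - s0) * e.
  have : (psi s - psi s0) ^+ 2 - (psi s - (psi s0 + c * (e / 2))) ^+ 2 +
      c ^+ 2 * (e / 2) ^+ 2 = (psi s - psi s0) * c * e by field.
  by rewrite A B c21 => <-; field.
have E : (psi s - psi s0) * c = s - s0 by exact: (mulIf (lt0r_neq0 e0) D).
rewrite -E; transitivity (psi s0 + c ^+ 2 * (psi s - psi s0)); last by ring.
by rewrite c21; ring.
Qed.

Lemma affine_in_itv (c t0 s0 s e : R) : c ^+ 2 = 1 ->
  `|s - s0| < t0 -> `|s - s0| < e - t0 -> 0 < t0 + c * (s - s0) < e.
Proof.
move=> c1; have c_norm : `|c| = 1 by apply/eqP; rewrite -sqr_norm_eq1 c1.
rewrite -(mul1r `|s - s0|) -c_norm -normrM !ltr_norml.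
by move=> /andP[? ?] /andP[? ?]; apply/andP; split; lra.
Qed.

End RealFunctions.

(** * Star charts and path components *)

Section StarCharts.
Context {R : realType} {X : metricType R} {x : X} (C : star_chart x).
Implicit Types (i j : 'I_(degree C)) (t : R).

Lemma mdist_arm_center j t : 0 <= t < Defs.radius C -> mdist x (arm j t) = t.
Proof.
move=> ht; have := @arm_isometry _ _ _ C j j 0 t.
rewrite arm_center eqxx sub0r normrN lexx Defs.radius_gt0 => -> //.
by case/andP: ht => t0 _; rewrite ger0_norm.
Qed.

Lemma arm_neq_center j t : 0 < t < Defs.radius C -> arm j t != x.
Proof.
move=> /andP[t0 tr]; apply/eqP => e; have := @mdist_arm_center j t.
by rewrite e mdistxx (ltW t0) tr => /(_ isT) z; rewrite -z ltxx in t0.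
Qed.

Lemma arm_cvg_center j : arm j t @[t --> 0^'+] --> x.
Proof.
apply/metricType_numDomainType.cvgrPdist_lt => e e0; near=> t.
have t0 : 0 < t by [].
have tr : t < Defs.radius C by near: t; apply: nbhs_right_lt; exact: Defs.radius_gt0.
rewrite mdist_arm_center ?(ltW t0) //; near: t; exact: nbhs_right_lt.
Unshelve. all: by end_near. Qed.

(** Leaving the arm means passing through the center, at distance [t]: a ball of radius at most [t]
    that stays inside the chart meets only this arm and misses the center. *)
Lemma arm_open : exists2 e : R, 0 < e <= Defs.radius C &
  forall j t, 0 < t < e -> exists2 d : R, 0 < d & forall p, mdist (arm j t) p < d ->
    exists2 s, 0 < s < Defs.radius C & p = arm j s.
Proof.
have /nbhs_ballP[e /= e0 eC] := arm_nbhs C.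
exists (Num.min (e / 2) (Defs.radius C)).
  by rewrite lt_min divr_gt0 // Defs.radius_gt0 ge_min lexx orbT.
move=> j t; rewrite lt_min => /and3P[t0 te tr].
exists (Num.min t (e / 2)); first by rewrite lt_min t0 divr_gt0.
move=> p; rewrite lt_min => /andP[pt pe].
have : ball x e p.
  rewrite ballEmdist /=; apply: le_lt_trans (metric_triangle x (arm j t) p) _.
  by rewrite mdist_arm_center ?(ltW t0) //; lra.
move=> /eC[i _ [s /= ]]; rewrite in_itv /= => sr ps; move: pt pe.
rewrite -ps arm_isometry ?(ltW t0) //; have [eji pt _|_ pt _] := eqVneq j i.
  exists s; last by rewrite eji.
  case/andP: sr => s0 ->; rewrite andbT lt_neqAle s0 andbT; apply/eqP => s0'.
  by rewrite -s0' subr0 gtr0_norm ?ltxx in pt.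
by case/andP: sr => s0 _; lra.
Qed.

(** [F] may contain the center, which is removed first; the rest is closed and misses [x], hence
    misses a ball around [x]. *)
Lemma arm_avoid_finite (F : set X) : finite_set F ->
  exists2 e : R, 0 < e & forall j t, 0 < t < e -> t < Defs.radius C -> ~ F (arm j t).
Proof.
move=> Ffin; have Fx : finite_set (F `\ x) by exact: finite_setD.
have /accessible_finite_set_closed/(_ _ Fx) cl : accessible_space X.
  exact/hausdorff_accessible/metric_hausdorff.
have /nbhs_ballP[e /= e0 eF] : nbhs x (~` (F `\ x)).
  by apply: open_nbhs_nbhs; split; [exact: closed_openC | case=> _; apply].
exists e => // j t /andP[t0 te] tr Ft.
apply: (eF (arm j t)); first by rewrite ballEmdist /= mdist_arm_center ?(ltW t0).
by split => //; apply/eqP/arm_neq_center; rewrite t0.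
Qed.

End StarCharts.

Section PathComponents.
Context {X : topologicalType} {R : realType}.
Implicit Types (A : set X) (x y z : X).

Lemma within_continuous_comp {T U W : topologicalType} (D : set T) (E : set U)
    (f : U -> W) (g : T -> U) :
  {within E, continuous f} -> continuous g -> g @` D `<=` E ->
  {within D, continuous (f \o g)}.
Proof.
move=> /subspace_continuousP fc gc gD; apply/subspace_continuousP => t Dt B /fc.
move=> /(_ (gD _ (imageP _ Dt))) /gc ftB.
suff : nbhs t [set s | D s -> B (f (g s))] by [].
have {}ftB : nbhs t [set s | E (g s) -> B (f (g s))] := ftB.
by apply: filterS ftB => s /= + Ds; apply; apply: gD; exists s.
Qed.

Lemma path_component_refl A x : A x -> path_component R A x x.
Proof.
move=> Ax; exists (cst x); split => //; last by move=> _ [t _ <-].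
by apply: continuous_subspaceT => t; exact: cvg_cst.
Qed.

Lemma path_component_sym A x y : path_component R A x y -> path_component R A y x.
Proof.
move=> [p [pc p0 p1 pA]]; exists (fun t => p (1 - t)).
have itv (t : R) : `[0, 1]%classic t -> `[0, 1]%classic (1 - t).
  by rewrite /= !in_itv /= => /andP[? ?]; apply/andP; split; lra.
split; rewrite ?subr0 ?subrr //.
- apply: (within_continuous_comp pc) => [t|_ [t /itv ? <-] //].
  by apply: (@cvgB R R^o); [exact: cvg_cst | exact: cvg_id].
- by move=> _ [t /itv tI <-]; apply: pA; exists (1 - t).
Qed.

Lemma path_component_trans A x y z :
  path_component R A x y -> path_component R A y z -> path_component R A x z.
Proof.
move=> [p [pc p0 p1 pA]] [q [qc q0 q1 qA]].
pose r t := if t <= 1 / 2 then p (2 * t) else q (2 * t - 1).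
have lin (c : R) : continuous (fun t : R => 2 * t - c).
  move=> t; apply: (@cvgB R R^o); last exact: cvg_cst.
  by apply: (@cvgM R); [exact: cvg_cst | exact: cvg_id].
exists r; split.
- have -> : `[0, 1]%classic = `[0, 1 / 2] `|` `[1 / 2, 1] :> set R.
    apply/seteqP; split => t; rewrite /= !in_itv /=.
      by move=> /andP[? ?]; have [?|/ltW ?] := leP t (1 / 2); [left|right]; apply/andP.
    by move=> [|] /andP[? ?]; apply/andP; split; lra.
  apply: withinU_continuous; [exact: interval_closed..| |].
    apply: (@subspace_eq_continuous _ _ _ (p \o (fun t : R => 2 * t - 0))).
      by move=> t; rewrite inE /= in_itv /= /from_subspace /r subr0 => /andP[_ ->].
    apply: (within_continuous_comp pc); first exact: lin.
    by move=> _ [t + <-]; rewrite /= !in_itv /= => /andP[? ?]; apply/andP; split; lra.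
  apply: (@subspace_eq_continuous _ _ _ (q \o (fun t : R => 2 * t - 1))).
    move=> t; rewrite inE /= in_itv /= /from_subspace /r => /andP[t2 _].
    case: leP => // t2'; have -> : t = 1 / 2 by apply/eqP; rewrite eq_le t2 t2'.
    by rewrite (_ : 2 * (1 / 2) = 1 :> R) ?subrr ?p1 //; field.
  apply: (within_continuous_comp qc); first exact: lin.
  by move=> _ [t + <-]; rewrite /= !in_itv /= => /andP[? ?]; apply/andP; split; lra.
- by rewrite /r ifT ?mulr0 //; lra.
- have -> : r 1 = q (2 * 1 - 1) by rewrite /r lt_geF //; lra.
  by rewrite -q1; congr q; ring.
- move=> _ [t /= + <-]; rewrite in_itv /= /r => /andP[? ?]; case: leP => ?.
    by apply: pA; exists (2 * t) => //=; rewrite in_itv /=; apply/andP; split; lra.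
  by apply: qA; exists (2 * t - 1) => //=; rewrite in_itv /=; apply/andP; split; lra.
Qed.

Lemma path_component_eq A x y z :
  path_component R A x z -> path_component R A y z ->
  path_component R A x = path_component R A y.
Proof.
move=> xz yz; have xy := path_component_trans xz (path_component_sym yz).
apply/seteqP; split => t; apply: path_component_trans => //.
exact: path_component_sym.
Qed.

End PathComponents.

(** * Edges and arms *)

Section Edges.
Context {R : realType} {X : metricType R} {G : metric_graph X}.
Variable V : finite_vertex_set G.
Implicit Types (e : edge V) (s t : R) (p x y : X).

Lemma edge_covers p : ~ vertex V p -> exists e s, edge_dom e s /\ edge_map e s = p.
Proof.
move=> Vp; have : [set path_component R (~` vertex V) x | x in ~` vertex V]
    (path_component R (~` vertex V) p) by exists p.
rewrite -edge_components => -[e _ eE]; exists e.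
have : (edge_map e @` edge_dom e) p by rewrite eE; exact: path_component_refl.
by case=> s es <-; exists s.
Qed.

Lemma edge_path_component e : exists x,
  edge_map e @` edge_dom e = path_component R (~` vertex V) x.
Proof.
have : [set edge_map e @` edge_dom e | e in [set: edge V]] (edge_map e @` edge_dom e).
  by exists e.
by rewrite edge_components => -[x _ <-]; exists x.
Qed.

(** Edges are path components, so a common point makes their images equal, and [edge_uniq]
    identifies the indices. *)
Lemma edges_disjoint e e' s s' : edge_dom e s -> edge_dom e' s' ->
  edge_map e s = edge_map e' s' -> e = e'.
Proof.
move=> es es' ee'; have [x eE] := edge_path_component e.
have [x' eE'] := edge_path_component e'.
apply: edge_uniq; rewrite eE eE'; apply: (@path_component_eq _ _ _ _ _ (edge_map e s)).
  by rewrite -eE; exists s.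
by rewrite ee' -eE'; exists s'.
Qed.

(* Near an interior point of an arm, both the arm and the edge through this point
   are arc length parametrizations, hence they differ by an affine map of slope 1 or -1. *)
Lemma arm_edge x (F : set X) : finite_set F -> exists2 r : R, 0 < r <= Defs.radius (G x) &
  forall (j : 'I_(degree (G x))) t0, 0 < t0 < r ->
  exists e s0 (c d : R), [/\ c ^+ 2 = 1, 0 < d &
    forall s, `|s - s0| < d ->
      [/\ edge_dom e s, 0 < t0 + c * (s - s0) < r,
          edge_map e s = arm j (t0 + c * (s - s0)) & ~ F (edge_map e s)]].
Proof.
move=> Ffin; have [r0 /andP[r00 r0C] r0P] := arm_open (G x).
have FV : finite_set (F `|` vertex V) by rewrite finite_setU; split => //; exact: vertex_finite.
have [r1 r10 r1P] := arm_avoid_finite (G x) FV.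
pose r := Num.min r0 r1.
have rr0 : r <= r0 by rewrite ge_min lexx.
have rr1 : r <= r1 by rewrite ge_min lexx orbT.
exists r; first by rewrite lt_min r00 r10 (le_trans rr0 r0C).
move=> j t0 /andP[t00 t0r].
have t0C : t0 < Defs.radius (G x) by exact: lt_le_trans (lt_le_trans t0r rr0) r0C.
have [|d0 d00 d0P] := r0P j t0; first by rewrite t00 (lt_le_trans t0r).
have /edge_covers[e [s0 [es0 es0t0]]] : ~ vertex V (arm j t0).
  by move=> Vt; apply: (r1P j t0 _ t0C); [rewrite t00 (lt_le_trans t0r) | right].
have /nbhs_ballP[d1 /= d10 d1P] : nbhs s0 (edge_dom e).
  by apply: open_nbhs_nbhs; split; first exact: edge_dom_open.
have [[/= P Q] [/nbhs_ballP[d2 /= d20 d2P] /nbhs_ballP[d3 /= d30 d3Q]] PQ] :=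
  edge_map_isometry es0.
(* Within [d] of [s0] the point stays on arm [j], the parameter stays where the edge map is defined
   and isometric, and the affine arm parameter stays between 0 and [r]. *)
pose d := Num.min (Num.min (Num.min d0 d1) (Num.min d2 d3)) (Num.min t0 (r - t0)).
have d_gt0 : 0 < d by rewrite !lt_min d00 d10 d20 d30 t00 subr_gt0.
have dE s : `|s - s0| < d -> [/\ [/\ `|s - s0| < d0, edge_dom e s, P s & Q s],
    `|s - s0| < t0 & `|s - s0| < r - t0].
  rewrite !lt_min => /andP[/andP[/andP[? ?] /andP[? ?]] /andP[? ?]]; split => //.
  by split => //; [apply: d1P|apply: d2P|apply: d3Q]; rewrite /ball /= distrC.
have iso s s' : `|s - s0| < d -> `|s' - s0| < d ->
    mdist (edge_map e s) (edge_map e s') = `|s - s'|.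
  by move=> /dE[[_ _ Ps _] _ _] /dE[[_ _ _ Qs'] _ _]; exact: (PQ (s, s')).
have s0d : `|s0 - s0| < d by rewrite subrr normr0.
(* The position of [edge_map e s] on arm [j]; 0 is a dummy value out of range. *)
have arms s : exists t, `|s - s0| < d ->
    0 < t < Defs.radius (G x) /\ edge_map e s = arm j t.
  have [sd|/negP nsd] := boolP (`|s - s0| < d); last by exists 0.
  have [|t tC ->] := d0P (edge_map e s); last by exists t.
  by rewrite -es0t0 iso // distrC; case: (dE s sd) => -[].
have [psi psiP] := choice arms.
have psi_iso s s' : `|s - s0| < d -> `|s' - s0| < d -> `|psi s - psi s'| = `|s - s'|.
  move=> sd sd'; rewrite -(iso s s') //.
  have [/andP[ps0 psC] ->] := psiP s sd; have [/andP[ps0' psC'] ->] := psiP s' sd'.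
  by rewrite arm_isometry ?eqxx ?(ltW ps0) ?(ltW ps0').
have [c c1 cP] := isometry_affine d_gt0 psi_iso.
(* [arm j (psi s0)] and [arm j t0] are the same point, at distance zero. *)
have psi0 : psi s0 = t0.
  have [/andP[ps0 psC] e0] := psiP s0 s0d; apply/eqP; rewrite -subr_eq0 -normr_eq0.
  have := mdistxx (arm j t0); rewrite -{1}es0t0 e0 arm_isometry ?(ltW ps0) ?(ltW t00) //.
  by rewrite eqxx => ->.
exists e, s0, c, d; split => // s sd; have [[_ es _ _] st0 srt0] := dE s sd.
have tr := affine_in_itv c1 st0 srt0.
have eE : edge_map e s = arm j (t0 + c * (s - s0)).
  by have [_ ->] := psiP s sd; rewrite cP // psi0.
split => //; rewrite eE => Ft; case/andP: tr => tr0 trr.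
apply: (r1P j (t0 + c * (s - s0))); last by left.
  by rewrite tr0 (lt_le_trans trr).
exact: lt_le_trans (lt_le_trans trr rr0) r0C.
Qed.

(** Only the edge [e] meets the set, as distinct edges are disjoint; injectivity of [edge_map e]
    recovers the segment. *)
Lemma length_integral_segment (h : edge V -> R -> R) e a b :
  `[a, b] `<=` edge_dom e ->
  length_integral h (edge_map e @` `[a, b]) =
  \int[@lebesgue_measure R]_(s in `[a, b]) h e s.
Proof.
move=> abe; rewrite /length_integral (bigD1 e) //= big1 ?addr0 => [|e' /eqP e'e].
  congr (Rintegral _ _ _); apply/seteqP; split => [s /= [es [s' s'ab]]|s sab].
    by move/edge_map_inj => <- //; rewrite inE //; exact: abe.
  by split; [exact: abe | exists s].
rewrite (_ : _ `&` _ = set0) ?Rintegral_set0 //; apply/seteqP; split => // s.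
by move=> [es [s' /abe es' /esym ss']]; apply: e'e; apply: edges_disjoint ss'.
Qed.

End Edges.

(** * Derivatives and integrals under an affine change of parameter *)

Section Derivatives.
Context {R : realType}.
Implicit Types (f g h : R -> R) (s t c : R).

Lemma near_eq_derive1n f g n t : {near t, f =1 g} ->
  {near t, derive1n n f =1 derive1n n g}.
Proof.
move=> fg; elim: n => // n IHn.
apply: filterS (near_join IHn) => s fgs.
by rewrite !derive1nS !derive1E; exact: near_eq_derive.
Qed.

Lemma is_derive_affine c s0 t0 s : is_derive s 1 (fun s => t0 + c * (s - s0)) c.
Proof.
by apply: trigger_derive; rewrite subr0 add0r mul1r; exact: mulr1.
Qed.

Lemma continuous_affine c s0 t0 : continuous (fun s => t0 + c * (s - s0)).
Proof. by move=> s; apply: is_derive_continuous (is_derive_affine c s0 t0 s). Qed.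

(** Each differentiation brings out a factor [c]. With [c ^+ 2 = 1], second derivatives agree in the
    arm and edge parameters. *)
Lemma derive1n_affine g c s0 t0 n s : smooth g ->
  derive1n n (fun s => g (t0 + c * (s - s0))) s =
  c ^+ n * derive1n n g (t0 + c * (s - s0)).
Proof.
move=> gs; elim: n s => [s|n IHn s]; first by rewrite mul1r.
rewrite derive1nS (funext IHn) derive1E.
have dg : is_derive s 1 (derive1n n g \o (fun s => t0 + c * (s - s0)))
    (derive1n n.+1 g (t0 + c * (s - s0)) * c).
  exact: is_derive1_comp (smooth_is_derive _ _ gs) (is_derive_affine _ _ _ _).
have [dv e] := dg.
by rewrite (deriveMl _ dv) e exprS; ring.
Qed.

Lemma continuous_linear3 f g h (c d : R) :
  continuous f -> continuous g -> continuous h ->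
  continuous (fun s => f s + c * g s + d * h s).
Proof.
move=> cf cg ch s; apply: (@cvgD R R^o); first apply: (@cvgD R R^o).
- exact: cf.
- by apply: (@cvgM R); [exact: cvg_cst | exact: cg].
- by apply: (@cvgM R); [exact: cvg_cst | exact: ch].
Qed.

Lemma Rintegral_linear3 f g h (a b c d : R) :
  continuous f -> continuous g -> continuous h ->
  \int[@lebesgue_measure R]_(s in `[a, b]) (f s + c * g s + d * h s) =
  \int[@lebesgue_measure R]_(s in `[a, b]) f s +
  c * \int[@lebesgue_measure R]_(s in `[a, b]) g s +
  d * \int[@lebesgue_measure R]_(s in `[a, b]) h s.
Proof.
move=> cf cg ch.
have cM (k : R) (l : R -> R) : continuous l -> continuous (fun s => k * l s).
  by move=> cl s; apply: (@cvgM R); [exact: cvg_cst | exact: cl].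
have cD (k l : R -> R) : continuous k -> continuous l -> continuous (fun s => k s + l s).
  by move=> ck cl s; apply: (@cvgD R R^o); [exact: ck | exact: cl].
rewrite RintegralD //; [|exact/continuous_integrable_segment/cD/cM..|].
  rewrite RintegralD //; [|exact: continuous_integrable_segment..|].
    by rewrite !RintegralZl //; exact: continuous_integrable_segment.
  exact/continuous_integrable_segment/cM.
exact/continuous_integrable_segment/cM.
Qed.

End Derivatives.

(** * Continuity of real and imaginary parts *)

Section ContinuousParts.
Context {R : realType}.

Lemma continuous_Re (X : topologicalType) (u : X -> R[i]) :
  continuous (u : X -> R[i]^o) -> continuous (@complex.Re R \o u).
Proof.
move=> cu x; apply/cvgrPdist_lt => e e0.
have /cvgrPdist_lt/(_ e%:C) := cu x; rewrite ltcR => /(_ e0).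
apply: filterS => z; rewrite -ltcR; apply: le_lt_trans.
by rewrite -raddfB normc_ge_Re.
Qed.

Lemma continuous_Im (X : topologicalType) (u : X -> R[i]) :
  continuous (u : X -> R[i]^o) -> continuous (@complex.Im R \o u).
Proof.
move=> cu x; apply/cvgrPdist_lt => e e0.
have /cvgrPdist_lt/(_ e%:C) := cu x; rewrite ltcR => /(_ e0).
apply: filterS => z; rewrite -ltcR; apply: le_lt_trans.
rewrite -raddfB [leRHS]normc_def lecR -sqrtr_sqr ler_wsqrtr //.
by rewrite lerDr sqr_ge0.
Qed.

End ContinuousParts.

(** * The Helmholtz equation along an arm *)

Lemma complex_affine_eq0 (R : realType) (a b c d kappa mu : R) :
  (a +i* b) + (kappa +i* mu) * (c +i* d) = 0 ->
  a + (kappa * c - mu * d) = 0 /\ b + (kappa * d + mu * c) = 0.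
Proof. by case. Qed.

Section ArmEquation.
Context {R : realType} {X : metricType R} {G : metric_graph X}.
Variable V : finite_vertex_set G.

(** Makes the segment an admissible test set for [helmholtz]: an isometric image of a compact
    segment is compact, hence closed and Borel. *)
Lemma edge_segment_compact (e : edge V) (a b : R) :
  (forall s s', a <= s <= b -> a <= s' <= b ->
     mdist (edge_map e s) (edge_map e s') = `|s - s'|) ->
  borel_relatively_compact (edge_map e @` `[a, b]).
Proof.
move=> iso; have cK : compact (edge_map e @` `[a, b]).
  apply: continuous_compact; last exact: segment_compact.
  apply/subspace_continuousP => s; rewrite /= in_itv /= => sab.
  apply/metricType_numDomainType.cvgrPdist_lt => eps eps0.
  rewrite near_withinE; near=> s' => /=; rewrite in_itv /= => sab'.
  rewrite iso //; near: s'; exact: (@cvgr_dist_lt _ _ _ _ _ id).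
split; last by exists (edge_map e @` `[a, b]).
rewrite -[_ @` _]setCK -setTD; apply: sigma_algebraCD; apply: sub_sigma_algebra.
by apply: closed_openC; apply: compact_closed => //; exact: metric_hausdorff.
Unshelve. all: by end_near. Qed.

Lemma laplacian_real_segment (f : X -> R) (e : edge V) (a b : R) :
  `[a, b] `<=` edge_dom e ->
  (forall s, a <= s <= b -> sigma_real G f (edge_map e s) = 0) ->
  laplacian_real V f (edge_map e @` `[a, b]) =
  \int[@lebesgue_measure R]_(s in `[a, b]) (derive1n 2 (f \o edge_map e) s).
Proof.
move=> abe fs; rewrite /laplacian_real fsbig1 => [|_ [s + <-]].
  by rewrite addr0; apply: length_integral_segment.
by rewrite /= in_itv /=; exact: fs.
Qed.

Variables (y : X) (u : X -> R[i]) (k : R[i]) (kappa mu : R).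
Hypotheses (k2 : k ^+ 2 = kappa +i* mu) (ps : piecewise_smooth G u)
  (hu : helmholtz V k y u) (ku : kirchhoff G y u).
Let ur := @complex.Re R \o u.
Let ui := @complex.Im R \o u.

(** Tests the measure equation on a segment avoiding the source: the Dirac mass is absent, the
    Kirchhoff condition removes the atoms, and real and imaginary parts separate. *)
Lemma helmholtz_edge_segment (e : edge V) a b : a <= b -> `[a, b] `<=` edge_dom e ->
  (forall s s', a <= s <= b -> a <= s' <= b ->
     mdist (edge_map e s) (edge_map e s') = `|s - s'|) ->
  (forall s, a <= s <= b -> edge_map e s != y) ->
  let I (h : R -> R) := \int[@lebesgue_measure R]_(s in `[a, b]) h s in
  I (derive1n 2 (ur \o edge_map e)) +
    (kappa * I (ur \o edge_map e) - mu * I (ui \o edge_map e)) = 0 /\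
  I (derive1n 2 (ui \o edge_map e)) +
    (kappa * I (ui \o edge_map e) + mu * I (ur \o edge_map e)) = 0.
Proof.
move=> ab abe iso ey I; set A := edge_map e @` `[a, b].
have yA : y \notin A.
  by rewrite notin_setE => -[s]; rewrite /= in_itv /= => /ey/eqP.
have sA s : a <= s <= b -> sigma G u (edge_map e s) = 0 by move=> /ey; exact: ku.2.
have lr := @laplacian_real_segment ur e a b abe.
have li := @laplacian_real_segment ui e a b abe.
have := hu (edge_segment_compact iso).
rewrite -/A indicE (negbTE yA) k2 /laplacian /density_measure lr => [|s /sA [] //].
rewrite li => [|s /sA [] //].
rewrite (length_integral_segment (fun e t => complex.Re (u (edge_map e t))) abe).
rewrite (length_integral_segment (fun e t => complex.Im (u (edge_map e t))) abe).
exact: complex_affine_eq0.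
Qed.


Lemma arm_value_center (x : X) (j : 'I_(degree (G x))) (f : X -> R) (g : R -> R) (e : R) :
  0 < e -> continuous f -> continuous g ->
  (forall t, 0 < t < e -> f (arm j t) = g t) -> f x = g 0.
Proof.
move=> e0 cf cg fg; apply: (@cvg_unique R^o (@norm_hausdorff _ R^o) (g t @[t --> 0^'+])).
  apply: cvg_trans (cvg_comp _ _ (arm_cvg_center j) (cf x)); apply: near_eq_cvg.
  near=> t; have t0 : 0 < t by [].
  have te : t < e by near: t; exact: nbhs_right_lt.
  by rewrite /= fg // t0.
exact: cvg_at_right_filter (cg 0).
Unshelve. all: by end_near. Qed.

(** Around an interior point of the arm, passing to the edge parameter gives the equation integrated
    over all short centered segments; continuity of the smooth extensions then gives it at the
    point. *)
Lemma arm_equation x (j : 'I_(degree (G x))) :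
  exists (e : R) (gr gi : R -> R), [/\ 0 < e <= Defs.radius (G x), smooth gr, smooth gi,
    forall t, 0 <= t < e -> ur (arm j t) = gr t /\ ui (arm j t) = gi t &
    forall t, 0 < t < e ->
      derive1n 2 gr t + kappa * gr t - mu * gi t = 0 /\
      derive1n 2 gi t + kappa * gi t + mu * gr t = 0].
Proof.
(* The source is avoided on the whole open arm of length [r], even when [x] is the source. *)
have [r /andP[r0 rC] rP] := arm_edge V x (finite_set1 y).
have [er er0 [gr gr_smooth grE]] := ps.1 x j.
have [ei ei0 [gi gi_smooth giE]] := ps.2 x j.
pose e := Num.min r (Num.min er ei).
have [eLr eLer eLei] : [/\ e <= r, e <= er & e <= ei].
  by rewrite !ge_min !lexx ?orbT.
have e0 : 0 < e by rewrite !lt_min r0 er0 ei0.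
exists e, gr, gi; split => //; first by rewrite e0 (le_trans eLr).
  move=> t /andP[+ te]; rewrite le_eqVlt => /predU1P[<-|t0].
    rewrite arm_center; split.
      exact: arm_value_center er0 (continuous_Re ku.1)
        (@smooth_continuous _ gr 0%N gr_smooth) grE.
    exact: arm_value_center ei0 (continuous_Im ku.1)
      (@smooth_continuous _ gi 0%N gi_smooth) giE.
  by split; [apply: grE | apply: giE]; rewrite t0 (lt_le_trans te).
move=> t0 /andP[t00 t0e].
have [|ed [s0 [c [d [c1 d0 edP]]]]] := rP j t0; first by rewrite t00 (lt_le_trans t0e).
pose phi s := t0 + c * (s - s0).
have c_norm : `|c| = 1 by apply/eqP; rewrite -sqr_norm_eq1 c1.
(* Shrinks [d] so that arm positions stay below [e], where [gr] and [gi] represent [u]. *)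
pose d' := Num.min d (Num.min t0 (e - t0)).
have d'0 : 0 < d' by rewrite !lt_min d0 t00 subr_gt0.
have d'P s : `|s - s0| < d' -> `|s - s0| < d /\ 0 < phi s < e.
  rewrite lt_min => /andP[sd]; rewrite lt_min => /andP[st0 se].
  by split; last exact: affine_in_itv.
have eur s : `|s - s0| < d' -> (ur \o edge_map ed) s = (gr \o phi) s.
  move=> /d'P[/edP[_ _ eE _] /andP[? pe]]; rewrite /= eE.
  by apply: grE; apply/andP; split => //; exact: lt_le_trans pe eLer.
have eui s : `|s - s0| < d' -> (ui \o edge_map ed) s = (gi \o phi) s.
  move=> /d'P[/edP[_ _ eE _] /andP[? pe]]; rewrite /= eE.
  by apply: giE; apply/andP; split => //; exact: lt_le_trans pe eLei.
have near_d' s : `|s - s0| < d' -> \forall s' \near s, `|s' - s0| < d'.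
  move=> sd'; have : (fun s' : R => `|s' - s0|) s @[s --> s] --> `|s - s0|.
    by apply: cvg_norm; apply: (@cvgB R R^o); [exact: cvg_id | exact: cvg_cst].
  by move/cvgr_lt; apply.
have d2 (f : X -> R) g s : smooth g ->
    (forall s, `|s - s0| < d' -> (f \o edge_map ed) s = (g \o phi) s) ->
    `|s - s0| < d' -> derive1n 2 (f \o edge_map ed) s = derive1n 2 g (phi s).
  move=> gs fg /near_d' near_s.
  have fgs : {near s, f \o edge_map ed =1 g \o phi} by exact: filterS near_s.
  rewrite (nbhs_singleton (near_eq_derive1n 2 fgs)) [LHS]derive1n_affine //.
  by rewrite c1 mul1r.
have cont (g : R -> R) n : smooth g -> continuous (derive1n n g \o phi).
  move=> gs s; apply: continuous_comp; first exact: continuous_affine.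
  exact: smooth_continuous.
have phi0 : phi s0 = t0 by rewrite /phi subrr mulr0 addr0.
have seg m s : 0 < m < d' -> s0 - m <= s <= s0 + m -> `|s - s0| < d'.
  move=> /andP[_ md] /andP[s1 s2]; rewrite ltr_distl (lt_le_trans _ s1) ?(le_lt_trans s2) //.
    by rewrite ltrD2l.
  by rewrite ltrD2l ltrN2.
have weak m : 0 < m < d' ->
    \int[@lebesgue_measure R]_(s in `[s0 - m, s0 + m])
      (derive1n 2 gr (phi s) + kappa * gr (phi s) + - mu * gi (phi s)) = 0 /\
    \int[@lebesgue_measure R]_(s in `[s0 - m, s0 + m])
      (derive1n 2 gi (phi s) + kappa * gi (phi s) + mu * gr (phi s)) = 0.
  move=> md; have md0 : s0 - m <= s0 + m.
    by case/andP: md => /ltW m0 _; rewrite lerD2l (le_trans _ m0) // oppr_le0.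
  have eI f g : (forall s, `|s - s0| < d' -> f s = g s) ->
      \int[@lebesgue_measure R]_(s in `[s0 - m, s0 + m]) f s =
      \int[@lebesgue_measure R]_(s in `[s0 - m, s0 + m]) g s.
    move=> fg; apply: eq_Rintegral => s; rewrite inE /= in_itv /=.
    by move=> /(seg _ _ md); exact: fg.
  have [|s s'|s|hr hi] := @helmholtz_edge_segment ed (s0 - m) (s0 + m) md0.
  - by move=> s; rewrite /= in_itv /= => /(seg _ _ md)/d'P[/edP[]].
  - move=> /(seg _ _ md)/d'P[/edP[_ _ sE _] ps0] /(seg _ _ md)/d'P[/edP[_ _ sE' _] ps0'].
    have pC p : 0 < p < e -> 0 <= p < Defs.radius (G x).
      by move=> /andP[/ltW -> pe] /=; apply: lt_le_trans pe (le_trans eLr rC).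
    rewrite sE sE' arm_isometry ?pC // eqxx -[RHS]mul1r -c_norm -normrM.
    by congr `|_|; ring.
  - by move=> /(seg _ _ md)/d'P[/edP[_ _ _ /eqP]].
  rewrite (eI _ _ (fun s => @d2 ur gr s gr_smooth eur)) (eI _ _ eur) (eI _ _ eui) in hr.
  rewrite (eI _ _ (fun s => @d2 ui gi s gi_smooth eui)) (eI _ _ eur) (eI _ _ eui) in hi.
  have [cr ci] := (cont gr 0%N gr_smooth, cont gi 0%N gi_smooth).
  rewrite !Rintegral_linear3 //; [|exact: (cont gi 2%N)|exact: (cont gr 2%N)].
  by rewrite mulNr -!addrA; split; [exact: hr | exact: hi].
split.
  have := @continuous_integral0 _ (fun s =>
    derive1n 2 gr (phi s) + kappa * gr (phi s) + - mu * gi (phi s)) s0 d' d'0.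
  rewrite phi0 mulNr; apply; last by move=> m /weak[].
  by apply: continuous_linear3; [exact: (cont _ 2%N) | exact: (cont _ 0%N)..].
have := @continuous_integral0 _ (fun s =>
  derive1n 2 gi (phi s) + kappa * gi (phi s) + mu * gr (phi s)) s0 d' d'0.
rewrite phi0; apply; last by move=> m /weak[].
by apply: continuous_linear3; [exact: (cont _ 2%N) | exact: (cont _ 0%N)..].
Qed.

End ArmEquation.

(** * The maximum principle *)

Section EnergyFunction.
Context {R : realType} {X : topologicalType}.

(** The squared modulus as a real number, since the norm on [R[i]] takes values in [R[i]]. *)
Definition energy (u : X -> R[i]) (x : X) : R :=
  complex.Re (u x) ^+ 2 + complex.Im (u x) ^+ 2.

Lemma normr_sqr_energy (u : X -> R[i]) x : `|u x| ^+ 2 = (energy u x)%:C.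
Proof. by rewrite normc_def -rmorphXn /= sqr_sqrtr // addr_ge0 ?sqr_ge0. Qed.

Lemma energy_ge0 (u : X -> R[i]) x : 0 <= energy u x.
Proof. by rewrite addr_ge0 ?sqr_ge0. Qed.

Lemma continuous_energy (u : X -> R[i]) :
  continuous (u : X -> R[i]^o) -> continuous (energy u).
Proof.
move=> cu x; have [cr ci] := (@continuous_Re _ _ _ cu x, @continuous_Im _ _ _ cu x).
exact: (cvgD (cvgM cr cr) (cvgM ci ci)).
Qed.

Lemma visibility_regionE (u : X -> R[i]) (T : R) :
  visibility_region u T = [set x | T ^+ 2 < energy u x].
Proof.
by apply/seteqP; split => x; rewrite /visibility_region /= normr_sqr_energy -rmorphXn ltcR.
Qed.

End EnergyFunction.

Section EnergyOnArms.
Context {R : realType} {X : metricType R} {G : metric_graph X}.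
Variable V : finite_vertex_set G.

Lemma outgoing_derivativeE (x : X) (j : 'I_(degree (G x))) (f : X -> R) (g : R -> R)
    (e d : R) : 0 < e -> (forall t, 0 <= t < e -> f (arm j t) = g t) ->
  is_derive (0 : R) 1 g d -> outgoing_derivative f j = d.
Proof.
move=> e0 fg [dg <-]; have fx : f x = g 0 by rewrite -fg ?lexx ?arm_center.
apply: (@cvg_lim R^o); first exact: norm_hausdorff.
apply: cvg_trans (cvg_dnbhs_at_right dg); apply: near_eq_cvg.
near=> t; have t0 : 0 < t by [].
have te : t < e by near: t; exact: nbhs_right_lt.
by rewrite /= fx fg ?(ltW t0) // addr0 [t *: 1]mulr1 mulrC.
Unshelve. all: by end_near. Qed.

Lemma is_derive_sqrD (f g : R -> R) (f1 g1 t : R) :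
  is_derive t 1 f f1 -> is_derive t 1 g g1 ->
  is_derive t 1 (fun s => f s ^+ 2 + g s ^+ 2) (2 * (f t * f1 + g t * g1)).
Proof.
move=> df dg; have := is_deriveD (is_deriveM df df) (is_deriveM dg dg).
by move/is_derive_eq; apply; rewrite /GRing.scale /=; ring.
Qed.

Lemma is_derive_scaled_dot (f g f1 g1 : R -> R) (f2 g2 t : R) :
  is_derive t 1 f (f1 t) -> is_derive t 1 g (g1 t) ->
  is_derive t 1 f1 f2 -> is_derive t 1 g1 g2 ->
  is_derive t 1 (fun s => 2 * (f s * f1 s + g s * g1 s))
    (2 * (f1 t ^+ 2 + f t * f2 + (g1 t ^+ 2 + g t * g2))).
Proof.
move=> df dg df1 dg1.
have := is_deriveZ 2 (is_deriveD (is_deriveM df df1) (is_deriveM dg dg1)).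
by move/is_derive_eq; apply; rewrite /GRing.scale /=; ring.
Qed.

Variables (y : X) (u : X -> R[i]) (k : R[i]) (kappa mu : R).
Hypotheses (k2 : k ^+ 2 = kappa +i* mu) (kappa_lt0 : kappa < 0)
  (hu : fundamental_solution V k y u).

(** The terms in [mu] cancel in the second derivative of [gr ^+ 2 + gi ^+ 2]. The slope at the
    center is written with outgoing derivatives so that the Kirchhoff condition can be summed over
    the arms. *)
Lemma energy_arm x (j : 'I_(degree (G x))) :
  exists (e : R) (f f1 f2 : R -> R), [/\ 0 < e <= Defs.radius (G x),
    (forall t : R, is_derive t 1 f (f1 t)) /\ (forall t : R, is_derive t 1 f1 (f2 t)),
    forall t, 0 <= t < e -> energy u (arm j t) = f t,
    forall t, 0 < t < e -> - (2 * kappa) * f t <= f2 t &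
    f1 0 = 2 * (complex.Re (u x) * outgoing_derivative (@complex.Re R \o u) j +
                complex.Im (u x) * outgoing_derivative (@complex.Im R \o u) j)].
Proof.
have [ps hh ku] := hu; have [e [gr [gi [/andP[e0 eC] sr si gE ode]]]] :=
  arm_equation k2 ps hh ku j.
have dr n t := @smooth_is_derive _ gr n t sr.
have di n t := @smooth_is_derive _ gi n t si.
exists e, (fun s => gr s ^+ 2 + gi s ^+ 2),
  (fun s => 2 * (gr s * derive1n 1 gr s + gi s * derive1n 1 gi s)),
  (fun s => 2 * (derive1n 1 gr s ^+ 2 + gr s * derive1n 2 gr s +
                 (derive1n 1 gi s ^+ 2 + gi s * derive1n 2 gi s))); split.
- by rewrite e0.
- split=> t; first exact: is_derive_sqrD (dr 0%N t) (di 0%N t).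
  exact: is_derive_scaled_dot (dr 0%N t) (di 0%N t) (dr 1%N t) (di 1%N t).
- by move=> t /gE [<- <-].
- move=> t /ode [er ei].
  have -> : derive1n 2 gr t = mu * gi t - kappa * gr t.
    by move/eqP: er; rewrite subr_eq0 => /eqP <-; ring.
  have -> : derive1n 2 gi t = - mu * gr t - kappa * gi t.
    by move/eqP: ei; rewrite addr_eq0 mulNr => /eqP <-; ring.
  (* The difference is twice the squared modulus of the derivative of [u] along the arm. *)
  rewrite -subr_ge0; set A := (X in 0 <= X).
  rewrite (_ : A = 2 * (derive1n 1 gi t ^+ 2 + derive1n 1 gr t ^+ 2)); last by rewrite /A; ring.
  by rewrite mulr_ge0 // addr_ge0 ?sqr_ge0.
- have gx : (0 : R) <= 0 < e by rewrite e0 lexx.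
  have := gE _ gx; rewrite arm_center => -[<- <-].
  by rewrite (outgoing_derivativeE e0 (fun t ht => (gE t ht).1) (dr 0%N 0))
             (outgoing_derivativeE e0 (fun t ht => (gE t ht).2) (di 0%N 0)).
Qed.

Lemma energy_no_max x : x != y -> 0 < energy u x -> ~ (forall z, energy u z <= energy u x).
Proof.
move=> xy w0 wmax; have [_ _ [_ /(_ x xy)]] := hu.
move=> /eqP; rewrite eq_complex => /andP[/eqP /= sr /eqP /= si].
(* Half the slope of the energy at [x] along arm [j]. *)
pose dw (j : 'I_(degree (G x))) :=
  complex.Re (u x) * outgoing_derivative (@complex.Re R \o u) j +
  complex.Im (u x) * outgoing_derivative (@complex.Im R \o u) j.
have [j jP] : exists j, 0 <= dw j.
  apply: contrapT => /forallNP nj.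
  have : \sum_(j < degree (G x)) dw j = 0.
    rewrite big_split /= -!mulr_sumr; rewrite /sigma_real in sr si.
    by rewrite sr si !mulr0 addr0.
  (* All slopes negative would make the sum negative, as the degree is positive. *)
  apply/eqP; rewrite lt_eqF // [ltRHS](_ : 0 = \sum_(j < degree (G x)) 0); last by rewrite big1.
  apply: ltr_sum => [|j _]; last by rewrite ltNge; apply/negP; exact: nj.
  by apply/hasP; exists (Ordinal (degree_gt0 (G x))); rewrite ?mem_index_enum.
have [e [f [f1 [f2 [/andP[e0 eC] [df df1] fE f2P f10]]]]] := energy_arm j.
have f0 : f 0 = energy u x by rewrite -fE ?lexx ?arm_center.
have : \forall t \near 0, 0 < f t.
  by apply: (cvgr_gt (f 0) (is_derive_continuous (df 0))); rewrite f0.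
move=> /nbhs_ballP[d /= d0 dP].
(* [b] lies both where the arm formula holds and where [f] is positive, which makes [f2] positive
   between 0 and [b]. *)
pose b := Num.min d e / 2.
have me0 : 0 < Num.min d e by rewrite lt_min d0.
have b0 : 0 < b by rewrite divr_gt0.
have bme : b < Num.min d e by rewrite /b; lra.
have [bd be] : b < d /\ b < e by apply/andP; rewrite -lt_min.
have : f 0 < f b.
  apply: convex_lt df df1 _ _ => // [s /andP[s0 sb]|]; last by rewrite f10 mulr_ge0.
  apply: lt_le_trans (f2P s _); last by rewrite s0 (lt_trans sb).
  apply: mulr_gt0; first by rewrite oppr_gt0 pmulr_rlt0.
  by apply: dP; rewrite /ball /= sub0r normrN gtr0_norm // (lt_trans sb).
by rewrite f0 -fE ?(ltW b0) // ltNge wmax.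
Qed.

End EnergyOnArms.

(** * Visibility regions *)

(** Continuity estimate for the radial contraction across two arms, where distances are sums of arm
    coordinates. *)
Lemma scaled_sum_lt (R : realFieldType) (t t' s s' e : R) : 0 <= t <= 1 -> 0 <= t' <= 1 ->
  0 <= s -> 0 <= s' -> s + s' < e / 2 -> (1 - t) * s + (1 - t') * s' < e.
Proof.
move=> /andP[t0 t1] /andP[t'0 t'1] s0 s'0 ss'.
have : (1 - t) * s <= s by rewrite ler_piMl //; lra.
have : (1 - t') * s' <= s' by rewrite ler_piMl //; lra.
lra.
Qed.

(** The same estimate along one arm: the changes of time and of position each cost less than
    [e / 2]. *)
Lemma scaled_dist_lt (R : realFieldType) (t t' s s' r e : R) : 0 <= t <= 1 ->
  0 <= s' < r -> `|t - t'| * r < e / 2 -> `|s - s'| < e / 2 ->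
  `|(1 - t) * s - (1 - t') * s'| < e.
Proof.
move=> /andP[t0 t1] /andP[s'0 s'r] tt' ss'.
have -> : (1 - t) * s - (1 - t') * s' = (1 - t) * (s - s') - (t - t') * s' by ring.
apply: le_lt_trans (ler_normB _ _) _; rewrite !normrM.
have : `|1 - t| * `|s - s'| <= `|s - s'| by rewrite ler_piMl // ger0_norm; lra.
have : `|t - t'| * `|s'| <= `|t - t'| * r by rewrite ler_wpM2l // ger0_norm // ltW.
lra.
Qed.

(** * Radial contraction of star-shaped sets *)

Section StarContraction.
Context {R : realType} {X : metricType R} {x : X} (C : star_chart x).

(** The contraction multiplies the arm coordinate by [1 - t], bringing every point to the center at
    time 1. *)
Lemma star_contractible (r : R) (U : set X) : r <= Defs.radius C -> U x ->
  U `<=` \bigcup_j (arm (s0 := C) j @` `[0, r[) ->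
  (forall (j : 'I_(degree C)) t c, 0 <= t < r -> 0 <= c <= 1 ->
     U (arm j t) -> U (arm j (c * t))) ->
  contractible R U.
Proof.
move=> rC Ux Uarms Ustar; pose j0 := Ordinal (degree_gt0 C).
(* Arm coordinates on [U], with a dummy value elsewhere. The center lies on every arm; an arbitrary
   choice is harmless since [arm_isometry] covers all pairs of arms. *)
have /choice[p pP] : forall z, exists p : 'I_(degree C) * R,
    U z -> 0 <= p.2 < r /\ arm p.1 p.2 = z.
  move=> z; have [/Uarms[j _ [t tr <-]]|nUz] := pselect (U z); last by exists (j0, 0).
  by exists (j, t) => _; split; move: tr; rewrite /= in_itv.
have scaled (c t : R) : 0 <= c <= 1 -> 0 <= t < r -> 0 <= c * t < Defs.radius C.
  move=> /andP[c0 c1] /andP[t0 tr]; rewrite mulr_ge0 //=.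
  by apply: le_lt_trans (lt_le_trans tr rC); rewrite ler_piMl.
have comp01 (a : R) : 0 <= a <= 1 -> 0 <= 1 - a <= 1.
  by move=> /andP[a0 a1]; rewrite subr_ge0 a1 gerBl.
exists (fun q => arm (p q.2).1 ((1 - q.1) * (p q.2).2)); split.
- apply/subspace_continuousP => -[t z] [/= + Uz]; rewrite in_itv /= => t01.
  apply/metricType_numDomainType.cvgrPdist_lt => e e0; rewrite near_withinE.
  have r0 : 0 < r by have [/andP[p0 pr] _] := pP z Uz; exact: le_lt_trans p0 pr.
  have er0 : 0 < e / 2 / r by rewrite !divr_gt0.
  have e20 : 0 < e / 2 by rewrite divr_gt0.
  exists (ball t (e / 2 / r), ball z (e / 2)) => /=.
    by split; exact: nbhsx_ballx.
  move=> [t' z'] [/= tt' zz'] [/= + Uz']; rewrite in_itv /= => t'01.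
  have [pz zE] := pP z Uz; have [pz' zE'] := pP z' Uz'.
  have := zz'; rewrite ballEmdist /= -{1}zE -{1}zE'.
  have sub (q : R) : 0 <= q < r -> 0 <= q < Defs.radius C.
    by move=> /andP[-> /= qr]; exact: lt_le_trans rC.
  rewrite arm_isometry ?sub // arm_isometry ?scaled ?comp01 //.
  set s := (p z).2 in pz *; set s' := (p z').2 in pz' *.
  have tt'r : `|t - t'| * r < e / 2 by rewrite -ltr_pdivlMr.
  have [/andP[s0 _] /andP[s'0 _]] := (pz, pz').
  case: (_ == _) => ss'; first exact: scaled_dist_lt t01 pz' tt'r ss'.
  exact: scaled_sum_lt.
- move=> t z t01 Uz; have [pz zE] := pP z Uz; apply: Ustar; rewrite ?zE //.
  exact: comp01.
- by move=> z Uz; have [_ zE] := pP z Uz; rewrite /= subr0 mul1r.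
- by exists x => // z _; rewrite /= subrr mul0r arm_center.
Qed.

End StarContraction.

Section Visibility.
Context {R : realType} {X : metricType R} {G : metric_graph X}.
Variable V : finite_vertex_set G.

(** On the test set [[set y]] the zero function gives 0 on the left, whereas the Dirac mass is 1.
    This provides a point of positive energy. *)
Lemma not_fundamental_solution0 (k : R[i]) (y : X) :
  ~ fundamental_solution V k y (fun=> 0).
Proof.
move=> [_ hh _].
have ybr : borel_relatively_compact [set y].
  have cy : compact [set y] by exact: compact_set1.
  split; last by exists [set y].
  rewrite -[[set y]]setCK -setTD; apply: sigma_algebraCD; apply: sub_sigma_algebra.
  by apply: closed_openC; apply: compact_closed => //; exact: metric_hausdorff.
have li0 (h : edge V -> R -> R) : (forall e t, h e t = 0) -> length_integral h [set y] = 0.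
  move=> h0; apply: big1 => e _; under eq_Rintegral do rewrite h0.
  by rewrite /Rintegral integral0.
have lap0 : laplacian_real V (fun=> 0) [set y] = 0.
  rewrite /laplacian_real li0 => [|e t]; last first.
    have d0 : derive1 (cst 0 : R -> R) = cst 0 by apply/funext => s; exact: derive1_cst.
    by rewrite derive1nS derive1n1 [in LHS](_ : _ \o _ = cst 0) // !d0.
  rewrite fsbig1 ?addr0 // => x _; apply: big1 => j _; rewrite /outgoing_derivative.
  under eq_fun do rewrite subrr mul0r.
  by apply: (@cvg_lim R^o); [exact: norm_hausdorff | exact: cvg_cst].
have := hh _ ybr; rewrite /laplacian /density_measure.
rewrite (_ : @complex.Re R \o _ = fun=> 0) // (_ : @complex.Im R \o _ = fun=> 0) //.
rewrite lap0 !li0 // indicE mem_set // => /eqP.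
by rewrite [X in k ^+ 2 * X](_ : _ = 0) // mulr0 addr0 eq_complex /= eq_sym oner_eq0.
Qed.

Lemma vanishes_energy (u : X -> R[i]) (e : R) : vanishes_at_infinity u -> 0 < e ->
  exists2 K, compact K & forall x, ~ K x -> energy u x < e.
Proof.
move=> uv e0; have [|K cK KP] := uv (Num.sqrt e); first by rewrite sqrtr_gt0.
exists K => // x /KP; rewrite normc_def ltcR -/(energy u x) ltr_sqrt //.
Qed.

Variables (y : X) (u : X -> R[i]) (k : R[i]) (kappa mu : R).
Hypotheses (k2 : k ^+ 2 = kappa +i* mu) (kappa_lt0 : kappa < 0)
  (hu : fundamental_solution V k y u) (uv : vanishes_at_infinity u).

Let energy_continuous : continuous (energy u).
Proof. by apply: continuous_energy; case: hu => _ _ []. Qed.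

Lemma energy_max_source : 0 < energy u y /\ forall x, x != y -> energy u x < energy u y.
Proof.
have [x0 wx0] : exists x0, 0 < energy u x0.
  apply: contrapT => /forallNP nw; apply: (@not_fundamental_solution0 k y).
  rewrite (_ : (fun=> 0) = u) //; apply/funext => x; apply/eqP; rewrite eq_sym -normr_eq0.
  rewrite -sqrf_eq0 normr_sqr_energy; apply/eqP; congr (_%:C); apply/eqP.
  by rewrite eq_le energy_ge0 andbT leNgt; apply/negP; exact: nw.
(* Outside [K] the energy is below its value at [x0], so a maximum over [K] is global. *)
have [K cK KP] := vanishes_energy uv wx0.
have Kx0 : K x0 by apply: contrapT => /KP; rewrite ltxx.
have [||x1 _ x1max] := @compact_EVT_max _ _ (energy u) K _ cK.
- by exists x0.
- exact: continuous_subspaceT.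
have {}x1max z : energy u z <= energy u x1.
  have [Kz|/KP/ltW zx0] := pselect (K z); first by apply: x1max; rewrite inE.
  by apply: le_trans zx0 _; apply: x1max; rewrite inE.
have wx1 : 0 < energy u x1 := lt_le_trans wx0 (x1max x0).
(* This also yields strictness: a point with the same energy as [y] would be another global
   maximum. *)
have max_y x : (forall z, energy u z <= energy u x) -> x = y.
  move=> xmax; apply: contrapT => /eqP xy.
  exact: (energy_no_max k2 kappa_lt0 hu xy (lt_le_trans wx1 (xmax x1)) xmax).
have x1y := max_y _ x1max; rewrite x1y in wx1 x1max.
split=> // x xy; rewrite lt_neqAle x1max andbT; apply: contraNneq xy => wxy.
by apply/eqP; apply: max_y => z; rewrite wxy.
Qed.

Lemma visibility_threshold : exists2 T : R, 0 < T &
  T ^+ 2 < energy u y /\ contractible R (visibility_region u T).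
Proof.
have [wy0 wmax] := energy_max_source.
(* At a good radius the end point [arm j r] is still in the chart and the energy there is still
   given by the convex function. *)
pose good (j : 'I_(degree (G y))) (r : R) := r < Defs.radius (G y) /\
  exists f f1 f2 : R -> R, [/\ (forall t : R, is_derive t 1 f (f1 t)),
    (forall t : R, is_derive t 1 f1 (f2 t)),
    (forall t, 0 <= t <= r -> energy u (arm j t) = f t) &
    forall t, 0 < t < r -> 0 <= f2 t].
have [r [r0 rgood]] : exists r : R, 0 < r /\ forall j, good j r.
  have goodj j : \forall r \near (0 : R)^'+, good j r.
    have [e [f [f1 [f2 [/andP[e0 eC] [df df1] fE f2P _]]]]] :=
      energy_arm k2 hu j.
    near=> r; have r0 : 0 < r by [].
    have re : r < e by near: r; exact: nbhs_right_lt.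
    split; first exact: lt_le_trans eC.
    exists f, f1, f2; split => // t /andP[t0 tr].
      by apply: fE; rewrite t0 (le_lt_trans tr).
    have te : t < e by exact: lt_trans re.
    have := f2P t; rewrite t0 te => /(_ isT); apply: le_trans.
    rewrite mulr_ge0 ?oppr_ge0 ?pmulr_rle0 ?(ltW kappa_lt0) //.
    by rewrite -fE ?energy_ge0 // (ltW t0).
  have [r [r0 rP]] := filter_ex (filterI (nbhs_right_gt (0 : R)) (filter_forall _ goodj)).
  by exists r.
have rC : r <= Defs.radius (G y).
  by have [/ltW] := rgood (Ordinal (degree_gt0 (G y))).
pose S := \bigcup_j (arm (s0 := G y) j @` `[0, r[).
have nS : nbhs y S.
  have sub : ball y r `&` \bigcup_j (arm (s0 := G y) j @` `[0, Defs.radius (G y)[) `<=` S.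
    move=> z [yz [j _ [t tC zE]]]; exists j => //; exists t => //; move: tC yz.
    rewrite -zE /= !in_itv /= => /andP[t0 tC].
    by rewrite ballEmdist /= mdist_arm_center ?t0.
  exact: (filterS sub (filterI (nbhsx_ballx _ _ r0) (arm_nbhs (G y)))).
have wy20 : 0 < energy u y / 2 by rewrite divr_gt0.
have [K cK KP] := vanishes_energy uv wy20.
(* The compact set [K] minus the interior of [S] omits [y], so the maximum of the energy on it is
   below [energy u y]; if this set is empty, 0 will do. *)
have [m my mP] : exists2 m, m < energy u y &
    forall z, K z -> ~ S° z -> energy u z <= m.
  have cKS : compact (K `&` ~` S°).
    by apply: compact_closedI => //; apply: open_closedC; exact: open_interior.
  have [[z0 Kz0]|KS0] := pselect (K `&` ~` S° !=set0); last first.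
    by exists 0 => // z Kz nSz; case: KS0; exists z.
  have [||z1 z1K z1max] := @compact_EVT_max _ _ (energy u) _ _ cKS.
  - by exists z0.
  - exact: continuous_subspaceT.
  exists (energy u z1) => [|z Kz nSz]; last by apply: z1max; rewrite inE.
  apply: wmax; apply/eqP => z1y; move: z1K; rewrite inE z1y => -[_]; exact.
(* The squared threshold: [m] controls the part of [K] off the star, half the peak controls the
   complement of [K]. *)
pose T2 := Num.max m (energy u y / 2).
have T20 : 0 < T2 by rewrite lt_max wy20 orbT.
have T2y : T2 < energy u y by rewrite gt_max my; lra.
have T2S z : ~ S z -> energy u z <= T2.
  move=> nSz; rewrite le_max; have [Kz|/KP/ltW ->] := pselect (K z); last by rewrite orbT.
  by rewrite mP // => /interior_subset.
exists (Num.sqrt T2); first by rewrite sqrtr_gt0.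
rewrite visibility_regionE sqr_sqrtr ?(ltW T20) //; split => //.
apply: (star_contractible rC) => //= [z Uz|j t c /andP[t0 tr] /andP[c0 c1] Ut].
  by apply: contrapT => /T2S; rewrite leNgt Uz.
have [rCj [f [f1 [f2 [df df1 fE f2P]]]]] := rgood j.
have [->|/eqP ct0] := eqVneq (c * t) 0; first by rewrite arm_center.
have [->//|/eqP ctt] := eqVneq (c * t) t.
have ct_gt0 : 0 < c * t by rewrite lt_neqAle eq_sym mulr_ge0 // andbT; apply/eqP.
have ct_lt : c * t < t by rewrite lt_neqAle ler_piMl // andbT; apply/eqP.
(* The end point is at distance exactly [r] from [y], hence outside [S]. *)
have wr : energy u (arm j r) <= T2.
  apply: T2S => -[i _ [s /= ]]; rewrite in_itv /= => /andP[s0 sr] e.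
  have := @mdist_arm_center _ _ _ (G y) j r; rewrite -e mdist_arm_center ?s0 ?(lt_trans sr) //.
  by rewrite (ltW r0) rCj => /(_ isT) sr'; rewrite sr' ltxx in sr.
(* Convexity between [c * t] and [r]: the energy exceeds [T2] at [t] but not at [r], so it must
   exceed [T2] at [c * t]. *)
have := @convex_le_max _ f f1 f2 (c * t) t r df df1.
rewrite ct_lt tr -!fE ?lexx ?(ltW r0) ?(ltW ct_gt0) ?t0 ?(ltW tr) ?(ltW (lt_trans ct_lt tr)) //.
move=> h; have {h}h : energy u (arm j t) <=
    Num.max (energy u (arm j (c * t))) (energy u (arm j r)).
  apply: h => // s /andP[cts sr]; apply: f2P; rewrite sr andbT; exact: lt_trans cts.
have := lt_le_trans Ut h; rewrite lt_max => /orP[//|].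
by rewrite ltNge wr.
Unshelve. all: by end_near. Qed.

End Visibility.

(** * Finite covers and the conclusion *)

Lemma open_visibility_region (R : realType) (X : topologicalType) (u : X -> R[i]) (T : R) :
  continuous (u : X -> R[i]^o) -> open (visibility_region u T).
Proof.
move=> cu; rewrite visibility_regionE.
have /continuousP/(_ _ (@open_gt R (T ^+ 2))) := continuous_energy cu.
by [].
Qed.

(** Near-covering form of compactness, along the filter of finite sequences ordered by inclusion:
    points near [x] are covered as soon as the sequence contains [x]. *)
Lemma compact_finite_subcover (X : topologicalType) (K : set X) (U : X -> set X) :
  compact K -> (forall y, nbhs y (U y)) ->
  exists s : seq X, K `<=` \bigcup_(y in [set` s]) U y.
Proof.
move=> /compact_near_coveringP cK nU.
pose F := filter_from [set: seq X] (fun s => [set s' : seq X | {subset s <= s'}]).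
have FF : Filter F.
  apply: filter_from_filter; first by exists [::].
  move=> s1 s2 _ _; exists (s1 ++ s2) => // s' /= sub.
  by split=> y ys; apply: sub; rewrite mem_cat ys ?orbT.
have [x Kx|s _ sP] := cK _ F (fun s => \bigcup_(y in [set` s]) U y) FF.
  exists (U x, [set s : seq X | {subset [:: x] <= s}]); first by split => //; exists [:: x].
  by move=> [z s] [/= Uz xs]; exists x => //; apply: xs; rewrite mem_head.
by exists s; apply: sP => y.
Qed.

(** The member [y] excludes the empty sequence, whose maximum is the default 0. *)
Lemma bigmax_const (R : realDomainType) (I : eqType) (s : seq I) (c : R) y :
  0 <= c -> y \in s -> \big[Num.max/0]_(z <- s) c = c.
Proof.
move=> c0; elim: s y => // z s IHs y _; rewrite big_cons.
case: s IHs => [|z' s] IHs; first by rewrite big_nil; apply/max_idPl.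
by rewrite (IHs z') ?mem_head // maxxx.
Qed.

Theorem theorem3 (R : realType) (X : metricType R) (G : metric_graph X)
    (V : finite_vertex_set G) (k' : R) (u : R -> X -> X -> R[i])
    (k'_gt0 : 0 < k')
    (u_fundamental : forall a y, 0 < a ->
       fundamental_solution V (k' +i* a) y (u a y))
    (u_vanishes : forall a y, 0 < a -> vanishes_at_infinity (u a y)) :
  exists alpha T : X -> R,
    let U (a : R) (y : X) := visibility_region (u a y) (T y) in
    [/\ forall y, [/\ 0 < alpha y, 0 < T y & contractible R (U (alpha y) y)],
        \bigcup_y U (alpha y) y = [set: X] &
        forall K : set X, compact K -> vertex V `<=` K ->
          (exists s : seq X, K `<=` \bigcup_(y in [set` s]) U (alpha y) y) /\
          (forall s : seq X, K `<=` \bigcup_(y in [set` s]) U (alpha y) y ->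
             let a := \big[Num.max/0]_(y <- s) alpha y in
             K `<=` \bigcup_(y in [set` s]) U a y /\
             forall y, y \in s -> contractible R (U a y))].
Proof.
pose a0 := k' + 1; have a0_gt0 : 0 < a0 by rewrite addr_gt0.
have k2 : (k' +i* a0) ^+ 2 = (k' ^+ 2 - a0 ^+ 2) +i* (2 * (k' * a0)).
  by rewrite expr2; congr (_ +i* _); ring.
have kappa_lt0 : k' ^+ 2 - a0 ^+ 2 < 0.
  by rewrite subr_lt0 ltr_pXn2r ?nnegrE ?(ltW k'_gt0) ?(ltW a0_gt0) // ltrDl.
have /choice[T TP] y : exists T : R, [/\ 0 < T, T ^+ 2 < energy (u a0 y) y &
    contractible R (visibility_region (u a0 y) T)].
  have [T T0 [Ty cT]] := visibility_threshold k2 kappa_lt0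
    (u_fundamental a0 y a0_gt0) (u_vanishes a0 y a0_gt0).
  by exists T.
exists (fun=> a0), T => U.
(* Each source lies in its own region, which gives the cover of [X]. *)
have Uy y : U a0 y y by rewrite /U visibility_regionE; case: (TP y).
split.
- by move=> y; case: (TP y).
- by apply/seteqP; split => // y _; exists y.
move=> K cK _; split.
  apply: compact_finite_subcover cK _ => y; apply: open_nbhs_nbhs; split => //.
  by apply: open_visibility_region; case: (u_fundamental a0 y a0_gt0) => _ _ [].
(* The maximum is evaluated only once a member of [s] is at hand; for empty [s] it is 0 and both
   claims are void. *)
move=> s Ks a; have aE y : y \in s -> a = a0 by exact/bigmax_const/ltW.
split=> [z /Ks[y ys Uz]|y ys]; last by rewrite (aE y ys); case: (TP y).
by exists y => //; rewrite (aE y ys).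
Qed.
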